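(* Let $F$ be a clause-set. Consider the following game between Prover and Delayer on a partial assignment $\theta$, where always $\mathrm{var}(\theta)\subseteq\mathrm{var}(F)$. Initially $\theta$ is the empty assignment; the players move alternately, Delayer first. A move of Delayer replaces $\theta$ by any $\theta'\supseteq\theta$. A move of Prover replaces $\theta$ by some $\theta'\supsetneq\theta$ such that either $\theta'*F=\top$ or $\theta'$ assigns exactly one more variable than $\theta$. The game ends as soon as $\bot\in\theta*F$ or $\theta*F=\top$; in the first case Delayer receives as many points as variables have been assigned by Prover's moves, in the second case Delayer receives $0$ points. Then Delayer has a strategy that always achieves at least $\mathrm{hd}(F)$ points, and Prover has a strategy ensuring that Delayer never gets $\mathrm{hd}(F)+1$ or more points.
   Context: Literals are variables $v$ or negations $\overline{v}$; a clause is a finite set of literals without complementary pair; a clause-set is a finite set of clauses; $\bot$ is the empty clause, $\top$ the empty clause-set; $\mathrm{var}(F)$ is the set of variables of $F$. A partial assignment $\varphi$ maps a finite set $\mathrm{var}(\varphi)$ of variables to $\{0,1\}$; $\varphi*F$ removes clauses containing a literal made true and removes false literals from the other clauses. $F$ is unsatisfiable if no $\varphi$ gives $\varphi*F=\top$. Resolution: clauses $C,D$ with $C\cap\overline{D}=\{x\}$ (exactly one clash) have resolvent $(C\cup D)\setminus\{x,\overline{x}\}$. A resolution tree is a finite rooted tree in which every inner node has exactly two children, nodes are labelled by clauses, and each inner node's label is the resolvent of its children's labels; a refutation of $F$ is a resolution tree with all leaf labels in $F$ and root label $\bot$. The Horton–Strahler number $\mathrm{hts}(T)$ of a binary tree is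 $0$ for a single node, and for a root with subtrees $T_1,T_2$ it is $\mathrm{hts}(T_1)+1$ if $\mathrm{hts}(T_1)=\mathrm{hts}(T_2)$ and $\max(\mathrm{hts}(T_1),\mathrm{hts}(T_2))$ otherwise. For unsatisfiable $F$, the hardness $\mathrm{hd}(F)$ is the minimum of $\mathrm{hts}(T)$ over refutations $T$ of $F$. Extension to all clause-sets: $\mathrm{hd}(\top):=0$, and for $F\ne\top$, $\mathrm{hd}(F):=\max\{\mathrm{hd}(\varphi*F):\varphi*F\text{ unsatisfiable}\}$. *)

(* Defs.v *)
From HB Require Import structures.
From mathcomp Require Import all_boot all_order finmap.
From mathcomp Require Import boolp classical_sets.

Set Implicit Arguments.
Unset Strict Implicit.
Unset Printing Implicit Defensive.

Local Open Scope fset_scope.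
Local Open Scope fmap_scope.

(* The literal (v, true) is the variable v, and (v, false) is its negation. *)
Definition literal (V : choiceType) : choiceType := (V * bool)%type.

Section ClauseSets.
Variable V : choiceType.
Implicit Types (L : {fset literal V}) (l x : literal V).

Definition neg l : literal V := (l.1, ~~ l.2).

Definition negs L : {fset literal V} := [fset neg l | l in L].

Definition clash_free L : bool := fdisjoint L (negs L).

Record clause := Clause { lits :> {fset literal V}; _ : clash_free lits }.

HB.instance Definition _ := [isSub for lits].
HB.instance Definition _ := [Choice of clause by <:].

Definition clauseset := {fset clause}.
Definition passign := {fmap V -> bool}.

Implicit Types (C D R : clause) (F : clauseset) (phi : passign).

Definition vars F : {fset V} := \bigcup_(C <- F) [fset l.1 | l in lits C].

Lemma negK : involutive neg.
Proof. by case=> v b; rewrite /neg /= negbK. Qed.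

Lemma mem_negs L l : (l \in negs L) = (neg l \in L).
Proof.
apply/imfsetP/idP => [[k /= kL ->]|nlL]; first by rewrite negK.
by exists (neg l); rewrite ?negK.
Qed.

Lemma clash_freeP L :
  reflect (forall l, l \in L -> neg l \notin L) (clash_free L).
Proof.
apply: (iffP (@fdisjointP _ L (negs L))) => h l lL; first by rewrite -mem_negs h.
by rewrite mem_negs h.
Qed.

Lemma clause_clash_free C : clash_free C.
Proof. exact: (valP C). Qed.

Lemma clash_free_sub L L' : L' `<=` L -> clash_free L -> clash_free L'.
Proof.
move=> /fsubsetP sL /clash_freeP cL; apply/clash_freeP => l lL'.
by apply: contra (cL l (sL l lL')) => /sL.
Qed.

Lemma clash_free0 : clash_free fset0.
Proof. exact: fdisjoint0X. Qed.

Definition bot : clause := Clause clash_free0.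
Definition top : clauseset := fset0.

Definition lit_true phi l : bool := phi.[? l.1] == Some l.2.
Definition lit_false phi l : bool := lit_true phi (neg l).
Definition satisfied phi C : bool := has (lit_true phi) (lits C).

Definition strip_lits phi C : {fset literal V} :=
  [fset l in lits C | ~~ lit_false phi l].

Lemma strip_clash_free phi C : clash_free (strip_lits phi C).
Proof.
apply: clash_free_sub (clause_clash_free C).
by apply/fsubsetP => l; rewrite !inE /= => /andP[].
Qed.

Definition strip phi C : clause := Clause (strip_clash_free phi C).

Definition apply_passign phi F : clauseset :=
  [fset strip phi C | C in F & ~~ satisfied phi C].

Definition unsat F : Prop := forall phi, apply_passign phi F <> top.

Definition is_resolvent C D R : Prop :=
  exists x, lits C `&` negs (lits D) = [fset x] /\
            lits R = (lits C `|` lits D) `\` [fset x; neg x].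

Inductive tree : Type := Leaf of clause | Node of clause & tree & tree.

Definition label (t : tree) : clause :=
  match t with Leaf C => C | Node C _ _ => C end.

Fixpoint resolution_tree F (t : tree) : Prop :=
  match t with
  | Leaf C => C \in F
  | Node C t1 t2 => [/\ is_resolvent (label t1) (label t2) C,
                        resolution_tree F t1 & resolution_tree F t2]
  end.

Definition refutation F (t : tree) : Prop :=
  resolution_tree F t /\ label t = bot.

Fixpoint hts (t : tree) : nat :=
  match t with
  | Leaf _ => 0
  | Node _ t1 t2 =>
      if hts t1 == hts t2 then (hts t1).+1 else maxn (hts t1) (hts t2)
  end.

(* Both are 0 by convention if the minimum, resp. maximum, does not exist; they
   do exist wherever hd_unsat and hd use them, see hd_unsatP and hdP below. *)
Definition nat_min (A : set nat) : nat := xget 0 (A `&` lbound A)%classic.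
Definition nat_max (A : set nat) : nat := xget 0 (A `&` ubound A)%classic.

Definition hd_unsat F : nat :=
  nat_min [set n | exists2 t, refutation F t & hts t = n]%classic.

Definition hd F : nat :=
  if `[< unsat F >] then hd_unsat F
  else if F == top then 0
  else nat_max [set n | exists2 phi, unsat (apply_passign phi F)
                                   & hd_unsat (apply_passign phi F) = n]%classic.

Inductive player := Delayer | Prover.

Definition over F (theta : passign) : bool :=
  (bot \in apply_passign theta F) || (apply_passign theta F == top).

Definition extends (theta theta' : passign) : Prop :=
  forall v, v \in domf theta -> theta'.[? v] = theta.[? v].

Definition move F (p : player) (theta theta' : passign) : Prop :=
  [/\ domf theta' `<=` vars F, extends theta theta' &
      if p is Prover then
        theta' <> theta /\
        (apply_passign theta' F = top \/
         #|` domf theta'| = #|` domf theta|.+1)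
      else True].

(* A history is the sequence of the assignments reached after each move, oldest
   first; the initial empty assignment is left out.  The entries with even
   index come from Delayer's moves, those with odd index from Prover's. *)
Definition history := seq passign.

Definition current (h : history) : passign := last [fmap] h.

Definition to_move (n : nat) : player := if odd n then Prover else Delayer.

Inductive play F : history -> Prop :=
| play_nil : play F [::]
| play_rcons h theta : play F h -> ~~ over F (current h) ->
    move F (to_move (size h)) (current h) theta -> play F (rcons h theta).

Definition complete_play F (h : history) : Prop :=
  play F h /\ over F (current h).

Definition prover_vars (h : history) : nat :=
  \sum_(i < size h | odd i)
    #|` domf (current (take i.+1 h)) `\` domf (current (take i h))|.

Definition points F (h : history) : nat :=
  if bot \in apply_passign (current h) F then prover_vars h else 0.

Definition strategy := history -> passign.

Definition is_strategy F (p : player) (s : strategy) : Prop :=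
  forall h, play F h -> ~~ over F (current h) -> to_move (size h) = p ->
    move F p (current h) (s h).

Definition follows (p : player) (s : strategy) (h : history) : Prop :=
  forall i, i < size h -> to_move i = p -> current (take i.+1 h) = s (take i h).

End ClauseSets.

Section WellDefined.
Variable V : choiceType.
Implicit Types (C D R : clause V) (F : clauseset V) (phi : passign V) (h : history V).

Lemma nat_minP (A : set nat) : (exists n, A n) ->
  A (nat_min A) /\ forall n, A n -> nat_min A <= n.
Proof.
move=> [m Am]; have Am' : exists n, `[< A n >] by exists m; apply/asboolP.
have : (A `&` lbound A)%classic (ex_minn Am').
  case: ex_minnP => k /asboolP Ak kmin; split=> // n An.
  by rewrite Order.NatOrder.leEnat; apply: kmin; apply/asboolP.
by move=> /(xgetI 0) [? lb]; split=> // n /lb; rewrite Order.NatOrder.leEnat.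
Qed.

Lemma nat_maxP (A : set nat) b : (exists n, A n) -> (forall n, A n -> n <= b) ->
  A (nat_max A) /\ forall n, A n -> n <= nat_max A.
Proof.
move=> [m Am] Ab; have Am' : exists n, `[< A n >] by exists m; apply/asboolP.
have Ab' n : `[< A n >] -> n <= b by move=> /asboolP; apply: Ab.
have : (A `&` ubound A)%classic (ex_maxn Am' Ab').
  case: ex_maxnP => k /asboolP Ak kmin; split=> // n An.
  by rewrite Order.NatOrder.leEnat; apply: kmin; apply/asboolP.
by move=> /(xgetI 0) [? lb]; split=> // n /lb; rewrite Order.NatOrder.leEnat.
Qed.

Lemma varsP F v :
  reflect (exists2 C, C \in F & exists2 l, l \in lits C & v = l.1) (v \in vars F).
Proof.
apply: (iffP (bigfcupP _ _ _ _)) => [[C /andP[CF _] /imfsetP[l /= lC ->]]|[C CF [l lC ->]]].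
  by exists C => //; exists l.
by exists C; rewrite ?CF //; apply/imfsetP; exists l.
Qed.

Lemma apply_passignP phi F C :
  reflect (exists D, [/\ D \in F, ~~ satisfied phi D & C = strip phi D])
          (C \in apply_passign phi F).
Proof.
apply: (iffP (imfsetP _ _ _ _)) => [[D /= /[!inE] /andP[DF nD] ->]|[D [DF nD ->]]].
  by exists D.
by exists D; rewrite //= !inE DF.
Qed.

Lemma lit_falseE phi (l : literal V) : lit_false phi l = (phi.[? l.1] == Some (~~ l.2)).
Proof. by []. Qed.

Lemma falsified_clash_free phi (L : {fset literal V}) :
  (forall l, l \in L -> lit_false phi l) -> clash_free L.
Proof.
move=> fL; apply/clash_freeP => -[v b] /fL; rewrite lit_falseE /= => /eqP e.
by apply/negP => /fL; rewrite lit_falseE /= e; case: b {e}.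
Qed.

Lemma refutation_gen F n phi : unsat F -> #|` vars F `\` domf phi| <= n ->
  exists t, [/\ resolution_tree F t, hts t <= n &
                forall l, l \in lits (label t) -> lit_false phi l].
Proof.
move=> uF; elim: n phi => [|n IH] phi len.
  have sub : vars F `<=` domf phi.
    by rewrite -fsetD_eq0 -cardfs_eq0 -leqn0.
  have [C Cin] : exists C, C \in apply_passign phi F.
    by apply/fset0Pn; apply/eqP; exact: uF.
  have [D [DF nD _]] := apply_passignP _ _ _ Cin.
  exists (Leaf D); split=> //= l lD; rewrite lit_falseE.
  have : l.1 \in domf phi by apply: (fsubsetP sub); apply/varsP; exists D => //; exists l.
  move/hasPn: nD => /(_ _ lD); rewrite /lit_true; case: fndP => // kf.
  by case: (phi _) (l.2) => [] [].
have [e|[v vin]] := fset_0Vmem (vars F `\` domf phi).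
  have [|t [rt ht ft]] := IH phi; first by rewrite e cardfs0.
  by exists t; split=> //; apply: leqW.
have Hb b : exists t, [/\ resolution_tree F t, hts t <= n &
                forall l, l \in lits (label t) -> lit_false phi.[v <- b] l].
  apply: IH; rewrite -ltnS; apply: leq_trans len.
  rewrite (cardfsD1 v (_ `\` domf phi)) vin ltnS; apply: fsubset_leq_card.
  by apply/fsubsetP => w; rewrite !inE !negb_or andbA.
have red b l : l.1 != v -> lit_false phi.[v <- b] l = lit_false phi l.
  by move=> nv; rewrite !lit_falseE fnd_set (negbTE nv).
have atv b l : l.1 = v -> lit_false phi.[v <- b] l -> l = (v, ~~ b).
  move=> <-; rewrite lit_falseE fnd_set eqxx => /eqP[->].
  by case: l => ? ? /=; rewrite negbK.
have easy b t : hts t <= n -> resolution_tree F t ->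
   (forall l, l \in lits (label t) -> lit_false phi.[v <- b] l) ->
   (v, ~~ b) \notin lits (label t) ->
   exists t, [/\ resolution_tree F t, hts t <= n.+1 &
                forall l, l \in lits (label t) -> lit_false phi l].
  move=> ht rt ft nin; exists t; split=> //; first exact: leqW.
  move=> l lt; rewrite -(red b) ?ft //; apply: contraNN nin => /eqP lv.
  by rewrite -(atv b l) ?ft.
have [t0 [r0 h0 f0]] := Hb false; have [t1 [r1 h1 f1]] := Hb true.
have [i0|/(easy _ _ h0 r0 f0)//] := boolP ((v, ~~ false) \in lits (label t0)).
have [i1|/(easy _ _ h1 r1 f1)//] := boolP ((v, ~~ true) \in lits (label t1)).
pose x : literal V := (v, true).
pose R := (lits (label t0) `|` lits (label t1)) `\` [fset x; neg x].
have fR l : l \in R -> lit_false phi l.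
  rewrite !inE negb_or => /andP[/andP[n1 n2] lin].
  have nv : l.1 != v.
    apply/negP => /eqP lv; case: l lv n1 n2 {lin} => w b /= ->.
    by rewrite /neg /x /=; case: b; rewrite eqxx.
  by case/orP: lin => [/f0|/f1]; rewrite red.
exists (Node (Clause (falsified_clash_free fR)) t0 t1); split=> //=.
  split=> //; exists x; split=> //; apply/fsetP => l; rewrite !inE mem_negs.
  apply/andP/eqP => [[l0 l1]|->]; last by split.
  have [lv|nv] := eqVneq l.1 v; first by rewrite (atv false l) ?f0.
  have := f0 _ l0; have := f1 _ l1; rewrite !red // !lit_falseE /= => /eqP ->.
  by case: (l.2).
by case: eqP => _; rewrite ?ltnS // geq_max !leqW.
Qed.

Lemma refutation_ex F : unsat F ->
  exists2 t, refutation F t & hts t <= #|` vars F|.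
Proof.
move=> uF; have [|t [rt ht ft]] := @refutation_gen F #|` vars F| [fmap] uF.
  by rewrite fsetD0.
exists t => //; split=> //; apply/val_inj/fsetP => l; rewrite in_fset0.
by apply/negP => /ft; rewrite lit_falseE fnd_fmap0.
Qed.

Lemma hd_unsatP F : unsat F ->
  (exists2 t, refutation F t & hts t = hd_unsat F) /\
  forall t, refutation F t -> hd_unsat F <= hts t.
Proof.
move=> uF; have [|e m] := @nat_minP [set n | exists2 t, refutation F t & hts t = n]%classic.
  by have [t rt _] := refutation_ex uF; exists (hts t); exists t.
by split=> // t rt; apply: m; exists t.
Qed.

Lemma vars_apply phi F : vars (apply_passign phi F) `<=` vars F.
Proof.
apply/fsubsetP => v /varsP[_ /apply_passignP[D [DF _ ->]] [l + ->]].
by rewrite !inE => /andP[lD _]; apply/varsP; exists D => //; exists l.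
Qed.

Lemma bot_unsat F : bot V \in F -> unsat F.
Proof.
move=> bF phi e; have : strip phi (bot V) \in apply_passign phi F.
  by apply/apply_passignP; exists (bot V); split.
by rewrite e in_fset0.
Qed.

Lemma hdP F : ~ unsat F -> F <> top V ->
  (exists2 phi, unsat (apply_passign phi F) & hd_unsat (apply_passign phi F) = hd F) /\
  forall phi, unsat (apply_passign phi F) -> hd_unsat (apply_passign phi F) <= hd F.
Proof.
move=> sF /eqP nF; rewrite /hd; case: asboolP => // _; rewrite (negbTE nF).
set A := [set n | _]%classic.
have [|n|e m] := @nat_maxP A #|` vars F|.
- have /fset0Pn[C CF] := nF.
  pose phi : passign V := [fmap v : [fset l.1 | l in lits C] => (val v, false) \in lits C].
  have fC l : l \in lits C -> lit_false phi l.
    move=> lC; rewrite lit_falseE; have lin : l.1 \in [fset l.1 | l in lits C].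
      by apply/imfsetP; exists l.
    rewrite in_fnd ffunE /=; apply/eqP; congr Some.
    case: l lC {lin} => v [] lC //=; apply/negbTE.
    exact: (clash_freeP _ (clause_clash_free C) _ lC).
  suff u : unsat (apply_passign phi F) by exists (hd_unsat (apply_passign phi F)), phi.
  apply: bot_unsat; apply/apply_passignP; exists C; split=> //.
    apply/hasPn => l /fC; rewrite lit_falseE /lit_true => /eqP ->.
    by case: (l.2).
  apply/val_inj/fsetP => l; rewrite !inE.
  by apply/esym/negbTE/negP => /andP[/fC ->].
- move=> [phi uphi <-]; have [t rt ht] := refutation_ex uphi.
  apply: leq_trans (fsubset_leq_card (vars_apply phi F)).
  exact: leq_trans ((hd_unsatP uphi).2 t rt) ht.
by split=> // phi uphi; apply: m; exists phi.
Qed.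

Lemma play_size F h : play F h -> size h <= (#|` vars F|).*2.+1.
Proof.
move=> ph.
suff : domf (current h) `<=` vars F /\ (size h)./2 <= #|` domf (current h)|.
  by move=> [/fsubset_leq_card + /leq_trans] => /[swap]/[apply]; rewrite leq_half_double.
elim: ph => [|h' th _ [sub le] no]; first by rewrite /= fsub0set.
rewrite /current last_rcons size_rcons => -[sth ext pm]; split=> //.
have sd : domf (current h') `<=` domf th.
  by apply/fsubsetP => v vi; rewrite -fndSome ext // fndSome.
apply: leq_trans (_ : #|` domf (current h')| + odd (size h') <= _).
  by rewrite -[leqLHS]/(uphalf _) uphalf_half addnC leq_add2r.
move: pm; rewrite /to_move; case: odd => /=.
  rewrite addn1 ltn_neqAle fsubset_leq_card // andbT => -[ne _].
  apply/negP => /eqP ec; apply: ne.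
  have ed : domf (current h') = domf th by apply/eqP; rewrite eqEfcard sd ec leqnn.
  apply/fmapP => k; have [kin|kn] := boolP (k \in domf (current h')); first exact: ext.
  have kn' : k \notin domf th by rewrite -ed.
  by rewrite !not_fnd.
by rewrite addn0 fsubset_leq_card.
Qed.
End WellDefined.

(* Main.v *)
Require Import Defs.
From mathcomp Require Import all_boot all_order finmap.
From mathcomp Require Import boolp.

(** Everything is read off one notion: a resolution tree over [F] of
    Horton-Strahler number at most [n] whose root clause is falsified by [phi].
    For unsatisfiable [phi * F] such a tree exists iff [hd (phi * F) <= n], since
    restricting it by [phi] gives a refutation of [phi * F], and lifting the
    leaves of a refutation of [phi * F] back to [F] only adds literals falsified
    by [phi].  Hence hardness is antitone in [phi]; it is at most
    [max (hd F_b + 1, hd F_(~b))], where [F_b] sets a variable to [b]; and unless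
    the empty clause is present, some variable and value lower it by one.

    Delayer first passes to an unsatisfiable instance of hardness [hd F], and
    then always extends to an assignment after which setting any single variable
    lowers the hardness by at most one.  Prover wins at once when the instance is
    satisfiable, and otherwise makes an assignment that lowers the hardness. *)

Set Implicit Arguments.
Unset Strict Implicit.
Unset Printing Implicit Defensive.

Local Open Scope fset_scope.
Local Open Scope fmap_scope.

(** * Hardness under partial assignments *)

Section Hardness.
Variable V : choiceType.
Implicit Types (C D R : clause V) (F : clauseset V) (l : literal V).
Implicit Types (phi theta rho : passign V) (t : tree V).

(** * Extensions of assignments and the truth of literals *)

Lemma extends_dom theta theta' : extends theta theta' ->
  domf theta `<=` domf theta'.
Proof. by move=> e; apply/fsubsetP => v vi; rewrite -fndSome e // fndSome. Qed.

Lemma extends_trans phi theta rho :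
  extends phi theta -> extends theta rho -> extends phi rho.
Proof.
by move=> e1 e2 v vi; rewrite e2 ?e1 // (fsubsetP (extends_dom e1)).
Qed.

Lemma extends_set theta v b : v \notin domf theta -> extends theta theta.[v <- b].
Proof. by move=> nv w wi; rewrite fnd_set; case: eqVneq wi nv => // -> ->. Qed.

Lemma lit_true_extends theta theta' l :
  extends theta theta' -> lit_true theta l -> lit_true theta' l.
Proof.
by rewrite /lit_true => e h; rewrite e // -fndSome (eqP h).
Qed.

Lemma lit_true_not_false phi l : lit_true phi l -> ~~ lit_false phi l.
Proof. by rewrite lit_falseE /lit_true => /eqP ->; case: (l.2). Qed.

Lemma lit_assigned phi l : l.1 \in domf phi -> lit_true phi l || lit_false phi l.
Proof.
rewrite lit_falseE /lit_true -fndSome; case: (phi.[? _]) => // b _.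
by case: b; case: (l.2).
Qed.

Lemma lit_unassigned phi l : l.1 \notin domf phi ->
  (lit_true phi l = false) * (lit_false phi l = false).
Proof. by move=> nl; rewrite lit_falseE /lit_true not_fnd. Qed.

Lemma falsified_not_satisfied phi C :
  (forall l, l \in lits C -> lit_false phi l) -> ~~ satisfied phi C.
Proof.
by move=> fC; apply/hasPn => l /fC; apply: contraTN => /lit_true_not_false.
Qed.

(** * Instances of a clause-set under partial assignments *)

Lemma bot_applyP phi F :
  reflect (exists2 C, C \in F & forall l, l \in lits C -> lit_false phi l)
          (bot V \in apply_passign phi F).
Proof.
apply: (iffP (apply_passignP _ _ _)) => [[C [CF _ e]]|[C CF fC]].
  exists C => // l lC; have : l \notin lits (strip phi C) by rewrite -e in_fset0.
  by rewrite !inE lC negbK.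
exists C; split=> //; first exact: falsified_not_satisfied.
apply/val_inj/fsetP => l; rewrite !inE.
by apply/esym/negbTE/negP => /andP[/fC ->].
Qed.

Lemma apply_topP phi F :
  apply_passign phi F = top V <-> (forall C, C \in F -> satisfied phi C).
Proof.
split=> [e C CF|h].
  apply/negPn/negP => nC; have : strip phi C \in apply_passign phi F.
    by apply/apply_passignP; exists C.
  by rewrite e in_fset0.
apply/fsetP => C; rewrite in_fset0; apply/negP => /apply_passignP[D [DF + _]].
by rewrite h.
Qed.

Lemma eq_apply phi theta F : (forall v, v \in vars F -> phi.[? v] = theta.[? v]) ->
  apply_passign phi F = apply_passign theta F.
Proof.
move=> e; have eC C l : C \in F -> l \in lits C -> phi.[? l.1] = theta.[? l.1].
  by move=> CF lC; apply: e; apply/varsP; exists C => //; exists l.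
have eS C : C \in F -> satisfied phi C = satisfied theta C.
  by move=> CF; apply: eq_in_has => l lC; rewrite /lit_true (eC C).
have eT C : C \in F -> strip phi C = strip theta C.
  move=> CF; apply/val_inj/fsetP => l; rewrite !inE; case: (boolP (l \in _)) => //= lC.
  by rewrite !lit_falseE (eC C).
apply/fsetP => C; apply/apply_passignP/apply_passignP => -[D [DF nD ->]]; exists D.
  by rewrite -eS // eT.
by rewrite eS // eT.
Qed.

(** Moves may assign variables of [F] only, while [unsat] and [hd] range over arbitrary assignments;
    restricting to [vars F] turns these into playable ones. *)
Lemma apply_restrict phi F : apply_passign phi.[& vars F] F = apply_passign phi F.
Proof. by apply: eq_apply => v vF; rewrite fnd_restrict vF. Qed.

Lemma extends_restrict theta rho F : domf theta `<=` vars F ->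
  extends theta rho -> extends theta rho.[& vars F].
Proof. by move=> s e v vi; rewrite fnd_restrict (fsubsetP s) ?e. Qed.

Lemma domf_restrict_sub theta F : domf theta.[& vars F] `<=` vars F.
Proof.
by apply/fsubsetP => v; rewrite -fndSome fnd_restrict; case: ifP.
Qed.

Lemma apply0 F : apply_passign [fmap] F = F.
Proof.
have ff l : lit_false [fmap] l = false by rewrite lit_falseE fnd_fmap0.
have s0 C : strip [fmap] C = C.
  by apply/val_inj/fsetP => l; rewrite !inE ff andbT.
apply/fsetP => C; apply/apply_passignP/idP => [[D [DF _ ->]]|CF].
  by rewrite s0.
by exists C; split; rewrite ?s0 //; apply/hasPn => l _; rewrite /lit_true fnd_fmap0.
Qed.

(** This form speaks of [F] itself instead of the instance, so that unsatisfiability visibly passes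
    to further extensions. *)
Lemma unsat_applyP theta F : unsat (apply_passign theta F) <->
  (forall rho, extends theta rho -> apply_passign rho F <> top V).
Proof.
split=> [u rho e /apply_topP h|h phi /apply_topP h'].
  apply: (u rho); apply/apply_topP => _ /apply_passignP[C [CF _ ->]].
  have /hasP[l lC tl] := h C CF; apply/hasP; exists l => //.
  rewrite !inE lC /=; apply/negP => /(lit_true_extends e) fl.
  by have := lit_true_not_false tl; rewrite /lit_false fl.
(* In [phi + theta] the values of [theta] take precedence, so it extends [theta]. *)
apply: (h (phi + theta)) => [v vi|]; first by rewrite fnd_cat vi.
apply/apply_topP => C CF.
have e : extends theta (phi + theta) by move=> v vi; rewrite fnd_cat vi.
have [/hasP[l lC tl]|nC] := boolP (satisfied theta C).
  by apply/hasP; exists l => //; apply: lit_true_extends e tl.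
have /h' /hasP[l] : strip theta C \in apply_passign theta F.
  by apply/apply_passignP; exists C.
rewrite !inE /= => /andP[lC nf] tl; apply/hasP; exists l => //.
have nt : ~~ lit_true theta l by apply: (hasPn nC).
have nd : l.1 \notin domf theta.
  by apply/negP => /lit_assigned; rewrite (negbTE nt) (negbTE nf).
by rewrite /lit_true fnd_cat (negbTE nd).
Qed.

Lemma unsat_extends theta theta' F : extends theta theta' ->
  unsat (apply_passign theta F) -> unsat (apply_passign theta' F).
Proof.
move=> e /unsat_applyP u; apply/unsat_applyP => rho e'.
exact/u/(extends_trans e).
Qed.

Lemma apply_vars_unassigned theta F C l :
  C \in apply_passign theta F -> l \in lits C -> l.1 \notin domf theta.
Proof.
move=> /apply_passignP[D [DF nD ->]]; rewrite !inE => /andP[lD nf].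
apply/negP => /lit_assigned; rewrite (negbTE nf) orbF => tl.
by case/hasP: nD; exists l.
Qed.

(** * Resolution trees: Horton-Strahler numbers, restriction and lifting *)

Lemma label_vars F t l : resolution_tree F t -> l \in lits (label t) -> l.1 \in vars F.
Proof.
elim: t l => [C l /= CF lC|R t1 IH1 t2 IH2 l /= [[x [_ eR]] /IH1 h1 /IH2 h2]].
  by apply/varsP; exists C => //; exists l.
by rewrite eR !inE => /andP[_ /orP[/h1|/h2]].
Qed.

(** Together with [hts_node_ge] this replaces the equality test in [hts]: a node has number at most
    [n] iff both children do and one of them lies below [n]. *)
Lemma hts_node_le C t1 t2 n : hts t1 <= n -> hts t2 <= n ->
  hts t1 < n \/ hts t2 < n -> hts (Node C t1 t2) <= n.
Proof.
move=> h1 h2 h; rewrite /=; case: eqP => [e|_]; last by rewrite geq_max h1.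
by case: h => //; rewrite -e.
Qed.

Lemma hts_node_ge C t1 t2 :
  [/\ hts t1 <= hts (Node C t1 t2), hts t2 <= hts (Node C t1 t2) &
      hts t1 < hts (Node C t1 t2) \/ hts t2 < hts (Node C t1 t2)].
Proof.
rewrite /=; case: eqP => [->|ne]; first by split=> //; left.
rewrite leq_maxl leq_maxr; split=> //.
by rewrite !leq_max ltnn; case: ltngtP ne => //; [left|right].
Qed.

(** Each parent contains only one of the two pivot literals, being clash-free, so resolving removes
    nothing else from it. *)
Lemma resolvent_sides C D R x l :
  lits C `&` negs (lits D) = [fset x] ->
  lits R = (lits C `|` lits D) `\` [fset x; neg x] ->
  (l \in lits C -> l = x \/ l \in lits R) /\
  (l \in lits D -> l = neg x \/ l \in lits R).
Proof.
move=> e eR; have [xC xD] : x \in lits C /\ neg x \in lits D.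
  by apply/andP; rewrite -mem_negs -in_fsetI e fset11.
have cl E y : y \in lits E -> neg y \notin lits E.
  exact: (clash_freeP _ (clause_clash_free E)).
rewrite eR !inE; split=> lin; rewrite lin ?orbT andbT.
  case: (eqVneq l x) => [|_] /=; [by left|right].
  by apply: contraTneq lin => ->; apply: cl.
case: (eqVneq l (neg x)) => [|_] /=; [by left|right; rewrite orbF].
by apply: contraTneq lin => ->; rewrite -[x]negK; apply: cl.
Qed.

(** If the pivot is assigned, the child whose pivot literal is false is not satisfied, and its
    restriction replaces the node. Otherwise the restricted children are resolved again, unless one
    of them has lost its pivot literal and already suffices. Labels may shrink in this way, hence an
    inclusion and not an equality. *)
Lemma restrict_tree phi F t : resolution_tree F t -> ~~ satisfied phi (label t) ->
  exists t', [/\ resolution_tree (apply_passign phi F) t', hts t' <= hts t &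
    lits (label t') `<=` strip_lits phi (label t)].
Proof.
elim: t => [C /= CF nC|R t1 IH1 t2 IH2].
  by exists (Leaf (strip phi C)); split=> //=; apply/apply_passignP; exists C.
move=> [[x [e eR]] r1 r2] nR.
have [h1 h2 hlt] := hts_node_ge R t1 t2; move: h1 h2 hlt.
set n := hts (Node _ _ _) => h1 h2 hlt.
have sides l := resolvent_sides l e eR.
have nRl l : l \in lits R -> ~~ lit_true phi l by apply: (hasPn nR).
have unsat1 : ~~ lit_true phi x -> ~~ satisfied phi (label t1).
  by move=> nx; apply/hasPn => l /(sides l).1 [->|/nRl].
have unsat2 : ~~ lit_true phi (neg x) -> ~~ satisfied phi (label t2).
  by move=> nx; apply/hasPn => l /(sides l).2 [->|/nRl].
have keep t t' (y : literal V) : lits (label t') `<=` strip_lits phi (label t) ->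
    (forall l, l \in lits (label t) -> l = y \/ l \in lits R) ->
    y \notin lits (label t') -> lits (label t') `<=` strip_lits phi R.
  move=> /fsubsetP s hR ny; apply/fsubsetP => l lt; have := s l lt.
  rewrite !inE => /andP[/hR[ely|->]//].
  by rewrite -ely lt in ny.
have nin t t' (y : literal V) : lits (label t') `<=` strip_lits phi (label t) ->
    lit_false phi y -> y \notin lits (label t').
  move=> /fsubsetP s fy; apply/negP => /s.
  by rewrite !inE fy andbF.
have [tx|nx] := boolP (lit_true phi x).
  have [|t' [rt' ht' st']] := IH2 r2 (unsat2 _).
    exact: lit_true_not_false.
  exists t'; split=> //; first exact: leq_trans h2.
  apply: (keep _ _ (neg x) st') => [l|]; first exact: (sides l).2.
  by apply: (nin _ _ _ st'); rewrite /lit_false negK.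
have [t1' [rt1 ht1 st1]] := IH1 r1 (unsat1 nx).
have done1 : x \notin lits (label t1') ->
  exists t', [/\ resolution_tree (apply_passign phi F) t', hts t' <= n &
    lits (label t') `<=` strip_lits phi R].
  move=> xn; exists t1'; split=> //; first exact: leq_trans h1.
  by apply: (keep _ _ x st1 _ xn) => l; exact: (sides l).1.
have [fx|nfx] := boolP (lit_false phi x); first exact: done1 (nin _ _ _ st1 fx).
have [t2' [rt2 ht2 st2]] := IH2 r2 (unsat2 nfx).
have [x1|//] := boolP (x \in lits (label t1')).
have [x2|x2] := boolP (neg x \in lits (label t2')); last first.
  exists t2'; split=> //; first exact: leq_trans h2.
  by apply: (keep _ _ (neg x) st2 _ x2) => l; exact: (sides l).2.
pose L := (lits (label t1') `|` lits (label t2')) `\` [fset x; neg x].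
have sL : L `<=` strip_lits phi R.
  apply/fsubsetP => l; rewrite /L in_fsetD [_ \in lits _ `|` _]in_fsetU => /andP[lx].
  case/orP => [/(fsubsetP st1)|/(fsubsetP st2)]; rewrite !inE => /andP[lin ->].
    by rewrite eR in_fsetD lx [_ \in lits _ `|` _]in_fsetU lin.
  by rewrite eR in_fsetD lx [_ \in lits _ `|` _]in_fsetU lin orbT.
have cL := clash_free_sub sL (strip_clash_free phi R).
exists (Node (Clause cL) t1' t2'); split=> //.
  (* The new labels contain only literals of the old ones, so no second clash can appear. *)
  split=> //; exists x; split=> //; apply/fsetP => l.
  rewrite in_fset1 in_fsetI mem_negs.
  apply/andP/eqP => [[l1 l2]|->]; last by [].
  apply/eqP; rewrite -in_fset1 -e in_fsetI mem_negs.
  have := fsubsetP st1 _ l1; have := fsubsetP st2 _ l2.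
  by rewrite !inE => /andP[-> _] /andP[-> _].
apply: hts_node_le; [exact: leq_trans h1|exact: leq_trans h2|].
by case: hlt => hlt; [left|right]; apply: leq_ltn_trans hlt.
Qed.

(** Each leaf is replaced by a clause of [F] that it comes from. The first conjunct serves the
    induction: labels avoid the variables of [phi], so the falsified literals that return clash
    neither with them nor with each other. A node collapses to a lifted child that lacks its pivot
    literal. *)
Lemma lift_tree phi F t : resolution_tree (apply_passign phi F) t ->
  (forall l, l \in lits (label t) -> l.1 \notin domf phi) /\
  exists t', [/\ resolution_tree F t', hts t' <= hts t &
    forall l, l \in lits (label t') -> lit_false phi l || (l \in lits (label t))].
Proof.
elim: t => [C /= CF|R t1 IH1 t2 IH2].
  split=> [l|]; first exact: apply_vars_unassigned CF.
  have [D [DF nD ->]] := apply_passignP _ _ _ CF.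
  exists (Leaf D); split=> //= l lD.
  by rewrite !inE lD /=; case: lit_false.
move=> [[x [e eR]] /IH1[u1 [t1' [rt1 ht1 st1]]] /IH2[u2 [t2' [rt2 ht2 st2]]]].
have uR l : l \in lits (label (Node R t1 t2)) -> l.1 \notin domf phi.
  by rewrite /= eR !inE => /andP[_ /orP[/u1|/u2]].
split=> //.
have [h1 h2 hlt] := hts_node_ge R t1 t2; move: h1 h2 hlt.
set n := hts (Node _ _ _) => h1 h2 hlt.
have sides l := resolvent_sides l e eR.
have [x1|x1] := boolP (x \in lits (label t1')); last first.
  exists t1'; split=> // [|l lt]; first exact: leq_trans h1.
  case/orP: (st1 l lt) => [->//|/(sides l).1 [lx|->]]; last by rewrite orbT.
  by rewrite lx (negbTE x1) in lt.
have [x2|x2] := boolP (neg x \in lits (label t2')); last first.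
  exists t2'; split=> // [|l lt]; first exact: leq_trans h2.
  case/orP: (st2 l lt) => [->//|/(sides l).2 [lx|->]]; last by rewrite orbT.
  by rewrite lx (negbTE x2) in lt.
pose L := (lits (label t1') `|` lits (label t2')) `\` [fset x; neg x].
have sL l : l \in L -> lit_false phi l || (l \in lits R).
  rewrite /L in_fsetD [_ \in lits _ `|` _]in_fsetU eR
    in_fsetD [_ \in lits _ `|` _]in_fsetU => /andP[->].
  by case/orP => [/st1|/st2] /orP[->|->] //; rewrite ?orbT.
have cL : clash_free L.
  apply/clash_freeP => l lL; apply/negP => nlL.
  have nb k : lit_false phi k -> neg k \in lits R -> false.
    by move=> fk /uR /lit_unassigned[]; rewrite -/(lit_false phi k) fk.
  have := sL _ nlL; have := sL _ lL => /orP [fl|lR] /orP[fnl|nlR].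
  - by have := lit_true_not_false fl; rewrite fnl.
  - by case: (nb _ fl nlR).
  - by have := nb _ fnl; rewrite negK => /(_ lR).
  - by have := clash_freeP _ (clause_clash_free R) _ lR; rewrite nlR.
exists (Node (Clause cL) t1' t2'); split=> //.
  split=> //; exists x; split=> //; apply/fsetP => l.
  rewrite in_fset1 in_fsetI mem_negs.
  apply/andP/eqP => [[l1 l2]|->]; last by [].
  have := st2 _ l2; have := st1 _ l1 => /orP [fl|lt1] /orP[fnl|lt2].
  - by have := lit_true_not_false fl; rewrite fnl.
  - by have := lit_unassigned (u2 _ lt2); rewrite -/(lit_false phi l) fl => -[].
  - by have := lit_unassigned (u1 _ lt1); rewrite /lit_false negK in fnl; rewrite fnl => -[].
  - by apply/eqP; rewrite -in_fset1 -e in_fsetI mem_negs lt1.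
apply: hts_node_le; [exact: leq_trans h1|exact: leq_trans h2|].
by case: hlt => hlt; [left|right]; apply: leq_ltn_trans hlt.
Qed.

(** * Hardness as derivability of a falsified clause *)

Definition derivable F phi n : Prop :=
  exists t, [/\ resolution_tree F t, hts t <= n &
                forall l, l \in lits (label t) -> lit_false phi l].

Lemma hd_unsat_applyP F phi n : unsat (apply_passign phi F) ->
  hd_unsat (apply_passign phi F) <= n <-> derivable F phi n.
Proof.
move=> u; have [[t [rt lt] ht] hmin] := hd_unsatP u; split=> [le|[t' [rt' ht' ft']]].
  have [_ [t' [rt' ht' st']]] := lift_tree rt.
  exists t'; split=> // [|l /st']; first by rewrite (leq_trans ht') // ht.
  by rewrite lt in_fset0 orbF.
(* A falsified root clause loses all its literals, so the restricted tree is a refutation. *)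
have [t0 [r0 h0 s0]] := restrict_tree rt' (falsified_not_satisfied ft').
apply: leq_trans (leq_trans h0 ht'); apply: hmin; split=> //.
apply/val_inj/fsetP => l; rewrite in_fset0; apply/negP => /(fsubsetP s0).
by rewrite !inE => /andP[/ft' ->].
Qed.

(** The tree stays the same; this is the benefit of deriving from [F] and not from its instances. *)
Lemma derivable_extends F theta theta' n : extends theta theta' ->
  derivable F theta n -> derivable F theta' n.
Proof.
move=> e [t [rt ht ft]]; exists t; split=> // l /ft.
exact: lit_true_extends.
Qed.

(** The two root clauses are resolved on [v]. The first tree lies strictly below [m.+1], so the new
    node does not exceed the bound. A root clause without its literal on [v] is already falsified by
    [theta]. *)
Lemma derivable_split F theta v b m n : v \notin domf theta ->
  derivable F theta.[v <- b] m -> derivable F theta.[v <- ~~ b] n ->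
  derivable F theta (maxn m.+1 n).
Proof.
move=> nv [t1 [r1 h1 f1]] [t2 [r2 h2 f2]].
(* The literal on [v] that becomes false when [v] is set to [b]. *)
pose x : literal V := (v, ~~ b).
have red c l : lit_false theta.[v <- c] l -> l = (v, ~~ c) \/ lit_false theta l.
  rewrite !lit_falseE fnd_set; case: (eqVneq l.1 v) => [lv|_]; last by right.
  by move=> /eqP[->]; left; case: l lv => w d /= ->; rewrite negbK.
have k1 l : l \in lits (label t1) -> l = x \/ lit_false theta l by move=> /f1 /red.
have k2 l : l \in lits (label t2) -> l = neg x \/ lit_false theta l by move=> /f2 /red.
have [x1|x1] := boolP (x \in lits (label t1)); last first.
  exists t1; split=> // [|l lt]; first by rewrite leq_max (leqW h1).
  by case: (k1 l lt) => // lx; rewrite lx (negbTE x1) in lt.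
have [x2|x2] := boolP (neg x \in lits (label t2)); last first.
  exists t2; split=> // [|l lt]; first by rewrite leq_max h2 orbT.
  by case: (k2 l lt) => // lx; rewrite lx (negbTE x2) in lt.
pose L := (lits (label t1) `|` lits (label t2)) `\` [fset x; neg x].
have fL l : l \in L -> lit_false theta l.
  rewrite !inE negb_or => /andP[/andP[n1 n2]] /orP[/k1|/k2] [e|//].
    by rewrite e eqxx in n1.
  by rewrite e eqxx in n2.
exists (Node (Clause (falsified_clash_free fL)) t1 t2); split=> //.
  split=> //; exists x; split=> //; apply/fsetP => l.
  rewrite in_fset1 in_fsetI mem_negs.
  apply/andP/eqP => [[l1 l2]|->]; last by [].
  have [//|fl] := k1 l l1; have [e|fnl] := k2 _ l2; first exact: (can_inj (@negK V)).
  by have := lit_true_not_false fl; rewrite fnl.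
apply: hts_node_le; rewrite ?leq_max ?h2 ?orbT ?(leqW h1) //.
by left; rewrite ltnS h1.
Qed.

(** One walks down from the root through clauses falsified by [theta]. At an assigned pivot one
    child is again falsified. No leaf is reached, since the empty clause is absent, so an unassigned
    pivot occurs. *)
Lemma derivable_descent F theta n : derivable F theta n ->
  bot V \notin apply_passign theta F ->
  exists v b, [/\ v \in vars F, v \notin domf theta &
    exists2 m, m < n & derivable F theta.[v <- b] m].
Proof.
move=> [t [rt ht ft]] /bot_applyP nb; elim: t rt ht ft => [C CF _ fC|].
  by case: nb; exists C.
move=> R t1 IH1 t2 IH2 [[x [e eR]] r1 r2] ht fR.
have [h1 h2 hlt] := hts_node_ge R t1 t2.
have sides l := resolvent_sides l e eR.
have k1 l : l \in lits (label t1) -> l = x \/ lit_false theta l.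
  by move=> /(sides l).1 [->|/fR]; [left|right].
have k2 l : l \in lits (label t2) -> l = neg x \/ lit_false theta l.
  by move=> /(sides l).2 [->|/fR]; [left|right].
have [xd|xd] := boolP (x.1 \in domf theta).
  case/orP: (lit_assigned xd) => fx.
    apply: IH2 => // [|l]; first exact: leq_trans ht.
    by case/k2 => // ->; rewrite /lit_false negK.
  apply: IH1 => // [|l]; first exact: leq_trans ht.
  by case/k1 => // ->.
have xF : x.1 \in vars F.
  apply: (label_vars r1).
  by move: (fset11 x); rewrite -e in_fsetI => /andP[].
(* One child has a strictly smaller number; the value is chosen to falsify the pivot literal of that
   child. *)
exists x.1; case: hlt => hlt; [exists (~~ x.2)|exists x.2]; split=> //.
  exists (hts t1); first exact: leq_trans ht.
  exists t1; split=> // l /k1 [->|fl].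
    by rewrite lit_falseE fnd_set eqxx.
  exact: lit_true_extends (extends_set _ xd) fl.
exists (hts t2); first exact: leq_trans ht.
exists t2; split=> // l /k2 [->|fl].
  by rewrite lit_falseE fnd_set eqxx /= negbK.
exact: lit_true_extends (extends_set _ xd) fl.
Qed.

(** * Hardness of unsatisfiable instances *)

Lemma hd_unsat_extends F theta theta' : extends theta theta' ->
  unsat (apply_passign theta F) ->
  hd_unsat (apply_passign theta' F) <= hd_unsat (apply_passign theta F).
Proof.
move=> e u; apply/(hd_unsat_applyP _ (unsat_extends e u)).
exact/(derivable_extends e)/(hd_unsat_applyP _ u).
Qed.

Lemma hd_unsat_split F theta v b : v \notin domf theta ->
  unsat (apply_passign theta F) ->
  hd_unsat (apply_passign theta F) <=
    maxn (hd_unsat (apply_passign theta.[v <- b] F)).+1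
         (hd_unsat (apply_passign theta.[v <- ~~ b] F)).
Proof.
move=> nv u; apply/(hd_unsat_applyP _ u).
have d c : derivable F theta.[v <- c] (hd_unsat (apply_passign theta.[v <- c] F)).
  have uc := unsat_extends (extends_set c nv) u.
  exact: ((hd_unsat_applyP _ uc).1 (leqnn _)).
exact: derivable_split nv (d b) (d (~~ b)).
Qed.

Lemma hd_unsat_descent F theta : unsat (apply_passign theta F) ->
  bot V \notin apply_passign theta F ->
  exists v b, [/\ v \in vars F, v \notin domf theta &
    hd_unsat (apply_passign theta.[v <- b] F) < hd_unsat (apply_passign theta F)].
Proof.
move=> u nb; have /(derivable_descent) := (hd_unsat_applyP _ u).1 (leqnn _).
move=> /(_ nb)[v [b [vF nv [m lt dm]]]]; exists v, b; split=> //.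
apply: leq_ltn_trans lt; apply/hd_unsat_applyP => //.
exact: unsat_extends (extends_set _ nv) u.
Qed.

Lemma hd_unsat_bot F theta : bot V \in apply_passign theta F ->
  hd_unsat (apply_passign theta F) = 0.
Proof.
move=> b; apply/eqP; rewrite -leqn0; apply/hd_unsat_applyP; first exact: bot_unsat.
by have [C CF fC] := bot_applyP _ _ b; exists (Leaf C).
Qed.

Lemma hd_unsat_le_hd F theta : unsat (apply_passign theta F) ->
  hd_unsat (apply_passign theta F) <= hd F.
Proof.
move=> u; have [uF|sF] := EM (unsat F).
  (* For unsatisfiable [F], [hd] is not defined as a maximum; [F] is its own instance under the
     empty assignment, and hardness is antitone. *)
  rewrite /hd asboolT // -{2}[F]apply0; apply: hd_unsat_extends.
    by move=> v; rewrite in_fset0.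
  by rewrite apply0.
have [e|ne] := EM (F = top V); last exact: (hdP sF ne).2.
by case: (u [fmap]); rewrite e; apply/apply_topP => C
  /apply_passignP[D []]; rewrite in_fset0.
Qed.

Lemma hd_attained F : F <> top V -> exists theta,
  [/\ domf theta `<=` vars F, unsat (apply_passign theta F) &
      hd F <= hd_unsat (apply_passign theta F)].
Proof.
move=> ne; have [uF|sF] := EM (unsat F).
  by exists [fmap]; rewrite apply0 /hd asboolT //; split=> //; rewrite fsub0set.
have [[phi u e] _] := hdP sF ne; exists phi.[& vars F].
by rewrite apply_restrict e; split=> //; apply: domf_restrict_sub.
Qed.

(** * Balanced assignments *)

Definition balanced F theta : Prop := forall v b, v \in vars F -> v \notin domf theta ->
  hd_unsat (apply_passign theta F) <= (hd_unsat (apply_passign theta.[v <- b] F)).+1.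

Lemma domf_set_sub F theta v b : v \in vars F -> domf theta `<=` vars F ->
  domf theta.[v <- b] `<=` vars F.
Proof.
by move=> vF s; rewrite dom_setf fsubUset fsub1set vF.
Qed.

(* If setting v to b drops the hardness by two or more, then setting v to ~~ b
   keeps it, so one reaches a balanced assignment by such steps. *)
Lemma balanced_extension F theta : domf theta `<=` vars F ->
  unsat (apply_passign theta F) ->
  exists theta', [/\ domf theta' `<=` vars F, extends theta theta',
    hd_unsat (apply_passign theta F) <= hd_unsat (apply_passign theta' F) &
    balanced F theta'].
Proof.
have [n] := ubnP #|` vars F `\` domf theta|; elim: n theta => // n IH theta.
(* The negated goal is used twice: first [theta] itself is offered, so that only its balance remains
   to be shown; then, where balance fails at [v], an extension from the induction hypothesis is
   offered. *)
rewrite ltnS => le s u; apply: contrapT => no; apply: (no); exists theta; split=> //.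
move=> v b vF nv; rewrite leqNgt; apply/negP => lt; apply: no.
have [||theta' [s' e' le' b']] := IH theta.[v <- ~~ b] _ (domf_set_sub _ vF s).
- apply: leq_trans le; rewrite (cardfsD1 v (_ `\` domf theta)) in_fsetD nv vF ltnS.
  by apply: fsubset_leq_card; apply/fsubsetP => w; rewrite !inE negb_or andbA.
- exact: unsat_extends (extends_set _ nv) u.
exists theta'; split=> //; first exact: extends_trans (extends_set _ nv) e'.
apply: leq_trans le'; have := hd_unsat_split b nv u.
by rewrite leq_max leqNgt lt.
Qed.

End Hardness.

(** * The game *)

Section Game.
Variables (V : choiceType) (F : clauseset V).
Implicit Types (h : history V) (theta : passign V).

(** * Histories, moves and strategies *)

Lemma current_rcons h theta : current (rcons h theta) = theta.
Proof. exact: last_rcons. Qed.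

Lemma prover_vars_rcons h theta : prover_vars (rcons h theta) =
  (prover_vars h + if odd (size h) then #|` domf theta `\` domf (current h)| else 0)%N.
Proof.
rewrite /prover_vars size_rcons big_mkcond big_ord_recr /= -big_mkcond /=.
rewrite take_oversize ?size_rcons // current_rcons -cats1 take_size_cat //.
congr addn; apply: eq_big => // i _.
by rewrite !takel_cat // ltnW.
Qed.

Lemma play_domf h : play F h -> domf (current h) `<=` vars F.
Proof.
by case=> [|h' theta _ _ []]; rewrite ?fsub0set ?current_rcons.
Qed.

Lemma prover_step theta theta' : extends theta theta' ->
  #|` domf theta'| = #|` domf theta|.+1 ->
  exists v b, v \notin domf theta /\ theta' = theta.[v <- b].
Proof.
move=> e c; have s := extends_dom e.
have /cardfs1P[v dv] : #|` domf theta' `\` domf theta| == 1.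
  by rewrite cardfsDS // c subSnn.
have : v \in domf theta' `\` domf theta by rewrite dv fset11.
rewrite in_fsetD => /andP[nv vin]; exists v, theta'.[vin]; split=> //.
apply/fmapP => w; rewrite fnd_set; case: eqVneq => [->|nw]; first exact: in_fnd.
have [wi|wn] := boolP (w \in domf theta); first exact: e.
rewrite !not_fnd //; apply: contra nw => wi.
by rewrite -in_fset1 -dv in_fsetD wn.
Qed.

(* The second premise demands a legal move even where [I] fails, because a
   strategy must be defined on all plays, not only on those that follow it. *)
Lemma strategy_invariant p (I : history V -> Prop) : I [::] ->
  (forall h, play F h -> ~~ Defs.over F (current h) -> to_move (size h) = p ->
     exists2 theta, move F p (current h) theta & I h -> I (rcons h theta)) ->
  (forall h theta, play F h -> ~~ Defs.over F (current h) -> to_move (size h) <> p ->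
     move F (to_move (size h)) (current h) theta -> I h -> I (rcons h theta)) ->
  exists s, is_strategy F p s /\ forall h, play F h -> follows p s h -> I h.
Proof.
move=> I0 Ip Io.
have /boolp.choice[s sP] : forall h, exists theta,
    play F h -> ~~ Defs.over F (current h) -> to_move (size h) = p ->
    move F p (current h) theta /\ (I h -> I (rcons h theta)).
  move=> h; have [[ph [no tm]]|n] :=
      EM (play F h /\ (~~ Defs.over F (current h) /\ to_move (size h) = p)).
    by have [theta m i] := Ip h ph no tm; exists theta.
  by exists [fmap] => ph no tm; case: n.
exists s; split=> [h ph no tm|h ph]; first by have [] := sP h ph no tm.
elim: ph => [//|h' theta ph IH no m] fo.
have Ih' : I h'.
  apply: IH => i lt tm; have := fo i; rewrite size_rcons => /(_ (ltnW lt) tm).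
  by rewrite -cats1 !takel_cat // ltnW.
have [tm|tm] := EM (to_move (size h') = p); last exact: Io m Ih'.
(* At the last index, [follows] identifies [theta] with the chosen move [s h']. *)
have := fo (size h'); rewrite size_rcons ltnSn => /(_ isT tm).
rewrite take_oversize ?size_rcons // current_rcons -cats1 take_size_cat // => ->.
by rewrite cats1; apply: (sP h' ph no tm).2.
Qed.

(** Delayer may pass; this is the default move where the invariant has been lost. *)
Lemma move_stay h : play F h -> move F Delayer (current h) (current h).
Proof. by move=> ph; split=> //; apply: play_domf. Qed.

Lemma to_move_Delayer n : to_move n = Delayer -> odd n = false.
Proof. by rewrite /to_move; case: odd. Qed.

Lemma to_move_Prover n : to_move n = Prover -> odd n.
Proof. by rewrite /to_move; case: odd. Qed.

Lemma move_set theta v b : domf theta `<=` vars F -> v \in vars F ->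
  v \notin domf theta -> move F Prover theta theta.[v <- b].
Proof.
move=> s vF nv; split; [exact: domf_set_sub|exact: extends_set|].
have c : #|` domf theta.[v <- b]| = #|` domf theta|.+1.
  by rewrite dom_setf cardfsU1 nv.
by split; [move=> e; move: c; rewrite e => /n_Sn|right].
Qed.

(** The invariant carries an unsatisfiable target [theta] beyond the current position whose
    hardness, added to the variables Prover has set, is at least [hd F]. The target is separate from
    the position because the play starts at the empty assignment, where the instance may be
    satisfiable. *)
Lemma delayer_strategy : exists s, is_strategy F Delayer s /\
  forall h, complete_play F h -> follows Delayer s h -> hd F <= points F h.
Proof.
(* Here the hardness is 0, so every legal strategy will do. *)
have [e|ne] := EM (F = top V).
  exists (@current V); split=> [h ph _ _|h _ _]; first exact: move_stay.
  by rewrite /hd e eqxx; case: asboolP => // /(_ [fmap]) []; rewrite apply0.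
pose I h := exists theta, [/\ domf theta `<=` vars F, extends (current h) theta,
  unsat (apply_passign theta F),
  hd F <= (prover_vars h + hd_unsat (apply_passign theta F))%N &
  odd (size h) -> theta = current h /\ balanced F theta].
have [|h ph _ /to_move_Delayer tm|h theta ph _ tm|s [sS sI]] :=
    @strategy_invariant Delayer I.
- have [theta [s u le]] := hd_attained ne; exists theta; split=> //.
  by rewrite /prover_vars big_ord0.
- have [[theta [s e u le _]]|nI] := EM (I h); last first.
    by exists (current h) => //; apply: move_stay.
  have [theta' [s' e' le' b']] := balanced_extension s u.
  have e2 := extends_trans e e'.
  exists theta' => // _; exists theta'; split=> //; rewrite ?current_rcons //.
    exact: unsat_extends e' u.
  rewrite prover_vars_rcons tm addn0; apply: leq_trans le _.
  by rewrite leq_add2l.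
- have -> : to_move (size h) = Prover by case: to_move tm.
  have od : odd (size h) by move: tm; rewrite /to_move; case: odd.
  move=> [s e [_ step]] [theta0 [_ _ u le /(_ od)[e0 bal]]]; subst theta0.
  have u' := unsat_extends e u.
  (* Prover cannot satisfy an unsatisfiable instance, so exactly one variable is set, and by balance
     this costs at most one unit of hardness. *)
  case: step => [/(proj1 (unsat_applyP _ _) u _ e)//|c].
  have [v [b [nv ev]]] := prover_step e c.
  exists theta; split; rewrite ?current_rcons ?size_rcons /= ?od //.
  rewrite prover_vars_rcons od cardfsDS ?extends_dom // c subSnn.
  apply: leq_trans le _; rewrite -addnA leq_add2l add1n ev; apply: bal => //.
  by apply: (fsubsetP s); rewrite ev dom_setf fset1U1.
exists s; split=> // h [ph ov] /(sI h ph)[theta [_ e u le _]].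
(* The play cannot have ended by satisfying [F], since the target would then satisfy [F] too. *)
have b : bot V \in apply_passign (current h) F.
  have /orP[//|/eqP t] := ov.
  have /apply_topP sat := t; case: (proj1 (unsat_applyP _ _) u theta) => //.
  apply/apply_topP => C /sat /hasP[l lC tl]; apply/hasP; exists l => //.
  exact: lit_true_extends e tl.
have b' : bot V \in apply_passign theta F.
  have [C CF fC] := bot_applyP _ _ b; apply/bot_applyP; exists C => // l /fC.
  exact: lit_true_extends e.
by rewrite /points b; rewrite hd_unsat_bot // addn0 in le.
Qed.

(** On unsatisfiable positions the variables set by Prover plus the remaining hardness stay within
    [hd F]. On satisfiable ones Prover has either set nothing yet or just ended the game, since
    there the first move of Prover satisfies [F]. *)
Lemma prover_strategy : exists s, is_strategy F Prover s /\
  forall h, complete_play F h -> follows Prover s h -> points F h <= hd F.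
Proof.
pose I h := (unsat (apply_passign (current h) F) ->
    (prover_vars h + hd_unsat (apply_passign (current h) F))%N <= hd F) /\
  (~ unsat (apply_passign (current h) F) ->
    prover_vars h = 0 \/ apply_passign (current h) F = top V).
have [|h ph no /to_move_Prover tm|h theta ph no tm|s [sS sI]] :=
    @strategy_invariant Prover I.
- rewrite /I /prover_vars big_ord0; split=> [u|]; last by left.
  exact: hd_unsat_le_hd.
- have [u|nu] := EM (unsat (apply_passign (current h) F)).
    have [|v [b [vF nv lt]]] := hd_unsat_descent u.
      by move: no; rewrite negb_or => /andP[].
    exists (current h).[v <- b]; first exact: move_set (play_domf ph) vF nv.
    (* The drop in hardness pays for the single variable assigned. *)
    move=> [/(_ u) le _]; split; rewrite current_rcons; last first.
      by case; apply: unsat_extends u; apply: extends_set.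
    move=> _; rewrite prover_vars_rcons tm cardfsDS ?extends_dom //; last first.
      exact: extends_set.
    rewrite dom_setf cardfsU1 nv addnK; apply: leq_trans le.
    by rewrite -addnA leq_add2l add1n.
  have [rho e t] : exists2 rho, extends (current h) rho & apply_passign rho F = top V.
    apply: contrapT => n; apply: nu; apply/unsat_applyP => rho e t.
    by apply: n; exists rho.
  have t' : apply_passign rho.[& vars F] F = top V by rewrite apply_restrict.
  exists rho.[& vars F].
    split; [exact: domf_restrict_sub|exact: extends_restrict (play_domf ph) e|].
    split; last by left.
    (* The move is a proper extension: the old position does not satisfy [F], as the game is not
       over. *)
    by move=> e'; move: no; rewrite /Defs.over -e' t' eqxx orbT.
  move=> _; split; rewrite current_rcons t'; last by right.
  by move=> /(_ [fmap]) []; rewrite apply0.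
- have tmD : to_move (size h) = Delayer by case: to_move tm.
  rewrite tmD => -[s e _] [iu isat].
  rewrite /I current_rcons prover_vars_rcons (to_move_Delayer tmD) addn0.
  have nt : apply_passign (current h) F <> top V.
    by move: no; rewrite negb_or => /andP[_ /eqP].
  have [u|nu] := EM (unsat (apply_passign (current h) F)).
    split=> [_|[]]; last exact: unsat_extends u.
    apply: leq_trans (iu u); rewrite leq_add2l; exact: hd_unsat_extends.
  (* Delayer may turn a satisfiable position into an unsatisfiable one only while Prover has set no
     variable, so the bound by [hd F] starts afresh. *)
  have [->|//] := isat nu; split=> [u|]; last by left.
  exact: hd_unsat_le_hd.
exists s; split=> // h [ph _] /(sI h ph)[iu _]; rewrite /points.
case: ifP => // /bot_unsat /iu; exact/leq_trans/leq_addr.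
Qed.

End Game.

Theorem theorem4p7 (V : choiceType) (F : clauseset V) :
  (exists s : strategy V, is_strategy F Delayer s /\
     forall h : history V, complete_play F h -> follows Delayer s h ->
       (hd F <= points F h)%N) /\
  (exists s : strategy V, is_strategy F Prover s /\
     forall h : history V, complete_play F h -> follows Prover s h ->
       ~ ((hd F).+1 <= points F h)%N).
Proof.
split; first exact: delayer_strategy.
have [s [sS sP]] := prover_strategy F; exists s; split=> // h ch fo.
by apply/negP; rewrite -leqNgt; apply: sP.
Qed.
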